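(* Let $q=3^m$ for some positive integer $m$ and let $n=2q$. The set $\mathcal{C}_2=\{T_{a,b,c}:(a,b,c)\in B\}$ of spanning trees defined in the context is an $\left(n,\frac{n(n-2)^2}{32},n-13\right)$ tree-code; that is, $|\mathcal{C}_2|=\frac{n(n-2)^2}{32}$ and any two distinct elements of $\mathcal{C}_2$ have tree-distance at least $n-13$.
   Context: For spanning trees $T_1=(V,E_1)$, $T_2=(V,E_2)$ on a common labelled vertex set $V$ with $|V|=n$, the tree-distance is $n-1-|E_1\cap E_2|$. An $(n,M,d)$ tree-code is a set of $M$ spanning trees of the complete graph on $n$ labelled vertices with pairwise tree-distance at least $d$. Construction: Let $\mathbb{F}_q$ be the field of $q=3^m$ elements with a primitive element $\omega$, let $V_i=\{(i,j):j\in\mathbb{F}_q\}$ for $i=1,2$, and $V=V_1\cup V_2$. Let $$B=\{(\omega^i,\omega^j,c): i=2,4,\dots,q-1;\ j=1,3,\dots,q-2;\ c\in\mathbb{F}_q\}.$$ For $(a,b,c)\in B$ the polynomial $ax^3-bx+c$ is a permutation polynomial over $\mathbb{F}_q$. The spanning tree $T_{a,b,c}$ on $V$ consists of the stem path visiting vertices in the order $$(1,1),(2,a\cdot1^3-b\cdot1+c),(1,\omega),(2,a\omega^3-b\omega+c),\dots,(1,\omega^j),(2,a\omega^{3j}-b\omega^j+c),\dots,(1,\omega^{q-2}),(2,a\omega^{3(q-2)}-b\omega^{q-2}+c)$$ (consecutive vertices joined by an edge), together with the branch consisting of the two edges $\{(1,a),(1,0)\}$ and $\{(1,0),(2,c)\}$.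 *)

(* Defs.v *)
From HB Require Import structures.
From mathcomp Require Import all_boot all_order all_algebra.

Set Implicit Arguments.
Unset Strict Implicit.
Unset Printing Implicit Defensive.

Import GRing.Theory.

Local Open Scope ring_scope.

(* Simple graphs on the labelled vertex set V are identified with their edge
   sets, an edge being a two-element set of vertices. *)
Section TreeCodes.

Variable V : finType.
Implicit Types (E T : {set {set V}}) (C : {set {set {set V}}}).

Definition adj E : rel V := [rel x y | [set x; y] \in E].

Definition connected E : Prop := forall x y : V, connect (adj E) x y.

(* The lists of size at most 2 are excluded since [:: x; y] satisfies ucycle as
   soon as {x, y} is an edge. *)
Definition acyclic E : Prop :=
  forall c : seq V, ucycle (adj E) c -> (size c <= 2)%N.

Definition spanning_tree E : Prop :=
  [/\ forall e, e \in E -> #|e| = 2%N, connected E & acyclic E].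

Definition tree_dist E1 E2 : int := #|V|%:Z - 1 - #|E1 :&: E2|%:Z.

Definition tree_code (n M : nat) (d : int) C : Prop :=
  [/\ #|V| = n,
      forall T, T \in C -> spanning_tree T,
      #|C| = M &
      forall T1 T2, T1 \in C -> T2 \in C -> T1 != T2 -> d <= tree_dist T1 T2].

Definition path_edges (s : seq V) : {set {set V}} :=
  [set [set p.1; p.2] | p in zip s (behead s)].

End TreeCodes.

(* The vertex set V_1 u V_2 is the disjoint sum F + F: the vertex (1, x) is
   inl x and the vertex (2, x) is inr x. *)
Section Construction.

Variables (F : finFieldType) (w : F).

Definition B : {set F * F * F} :=
  [set t : F * F * F |
    [exists i : 'I_#|F|, exists j : 'I_#|F|,
      [&& (2 <= i <= #|F| - 1)%N, ~~ odd i,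
          (1 <= j <= #|F| - 2)%N, odd j,
          t.1.1 == w ^+ i & t.1.2 == w ^+ j]]].

Definition cubic (a b c x : F) : F := a * x ^+ 3 - b * x + c.

Definition stem (a b c : F) : seq (F + F) :=
  flatten [seq [:: inl (w ^+ j); inr (cubic a b c (w ^+ j))]
          | j <- iota 0 (#|F| - 1)].

Definition tree_abc (a b c : F) : {set {set F + F}} :=
  path_edges (stem a b c)
    :|: [set [set inl a; inl 0]; [set inl 0; inr c]].

Definition C2 : {set {set {set F + F}}} :=
  [set tree_abc t.1.1 t.1.2 t.2 | t in B].

End Construction.

(* Main.v *)
Require Import Defs.
From HB Require Import structures.
From mathcomp Require Import all_boot all_order all_algebra.
From mathcomp Require Import finfield.
From mathcomp Require Import zify ring.

Set Implicit Arguments.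
Unset Strict Implicit.
Unset Printing Implicit Defensive.

Import GRing.Theory.

Local Open Scope ring_scope.

(** Write p(x) = a x^3 - b x + c. Apart from the single edge {(1,a), (1,0)},
    the tree T_{a,b,c} consists of edges between the two copies of F, of two
    kinds: the aligned edges {(1,x), (2,p(x))} for all x in F (the branch edge
    {(1,0), (2,c)} being the case x = 0), and the rotated edges
    {(1,wx), (2,p(x))} for x nonzero and wx different from 1. This description
    is [tree_edgesP], and everything is read off from it.

    - Spanning tree. Since p is a permutation ([cubic_inj]), every vertex other
      than (1,1) has a well defined predecessor, and the edges are exactly the
      pairs of a vertex and its predecessor; as the predecessor comes earlier
      in a suitable ranking of the vertices, the graph is a tree
      ([parent_spanning_tree]).

    - Size. The tree determines a (from its only edge inside the first copy),
      p(0) and p(1), hence (a, b, c) ([tree_inj]); and B is a product of two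
      sets of size (q - 1)/2 and of F ([card_B]).

    - Distance. A common edge of T_{a,b,c} and T_{a',b',c'} inside the first
      copy forces a = a'. Any other common edge gives a solution of p = p'
      (if it has the same kind in both trees, aligned or rotated), of
      p(wx) = p'(x), or of p'(wx) = p(x). Each of these is an equation of degree
      at most three. In the last two the leading coefficient does not vanish,
      since a and a' are even powers of w and w^3 is an odd one, so they account
      for at most 3 + 3 edges. The equation p = p' counts twice; it has at most
      three solutions if a <> a', and at most one if a = a', where its degree
      drops. So there are at most 3 + 3 + 6 = 12 common edges in the first case
      and 1 + 3 + 3 + 2 = 9 in the second ([card_common_edges]). *)

(** * Trees given by a parent function *)

Lemma adj_sym (V : finType) (E : {set {set V}}) : symmetric (adj E).
Proof. by move=> x y; rewrite /adj /= setUC. Qed.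

Section ParentTree.

Variables (V : finType) (E : {set {set V}}).
Variables (root : V) (parent : V -> V) (rank : V -> nat).
Hypothesis rank_parent : forall v, v != root -> (rank (parent v) < rank v)%N.
Hypothesis parent_edge : forall v, v != root -> [set v; parent v] \in E.
Hypothesis edge_parent :
  forall e, e \in E -> exists2 v, v != root & e = [set v; parent v].

Lemma parent_connected : connected E.
Proof.
have conn_root v : connect (adj E) root v.
  have [k] := ubnP (rank v); elim: k v => // k IHk v.
  rewrite ltnS => le_vk; have [-> | v_root] := eqVneq v root.
    exact: connect0.
  apply: connect_trans (IHk (parent v) _) _.
    exact: leq_trans (rank_parent v_root) le_vk.
  by apply: connect1; rewrite adj_sym; apply: parent_edge.
move=> x y; apply: connect_trans (conn_root y).
by rewrite (sym_connect_sym (adj_sym E)).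
Qed.

(** A neighbour of x that is not above x can only be its parent: otherwise x
    would be the parent of that neighbour, hence of strictly smaller rank. *)
Lemma adj_lower x y :
  adj E x y -> (rank y <= rank x)%N -> y != x -> y = parent x.
Proof.
move=> /edge_parent [v v_root xyE] le_yx y_x.
have : v \in [set x; y] by rewrite xyE set21.
have : y \in [set v; parent v] by rewrite -xyE set22.
have : x \in [set v; parent v] by rewrite -xyE set21.
rewrite !inE => xP yP /orP[] /eqP vE; subst v.
  by move: yP; rewrite (negbTE y_x) => /eqP.
move: xP; rewrite eq_sym (negbTE y_x) => /eqP xE.
by have := rank_parent v_root; rewrite -xE ltnNge le_yx.
Qed.

(** A vertex of largest rank on a cycle of length at least three would have two
   distinct neighbours of no larger rank, but its parent is the only
   possible one. *)
Lemma parent_acyclic : acyclic E.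
Proof.
case=> // v0 c0; set c := v0 :: c0 => c_cycle.
rewrite leqNgt; apply/negP => c_gt2.
have c_v0 : v0 \in c by exact: mem_head.
case: (arg_maxnP rank c_v0) => v c_v max_v.
(* Rotated to start at v, the cycle reads v, y, ..., z with y <> z. *)
have [i c' rotE] := rot_to c_v.
have rank_le u : u \in v :: c' -> (rank u <= rank v)%N.
  by rewrite -rotE mem_rot => /max_v.
move: c_cycle c_gt2; rewrite -(rot_ucycle i) -(size_rot i) rotE.
case: c' rotE rank_le => [|y c'] // _; case/lastP: c' => [|c' z] // rank_le.
rewrite /ucycle /= rcons_path last_rcons !mem_rcons !inE mem_rcons inE !negb_or.
case/and4P=> /and3P[vy _ zv] /and3P[v_y v_z _] /andP[y_z _] _ _.
have yE : y = parent v.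
  by apply: adj_lower; rewrite 1?eq_sym // rank_le // !inE eqxx orbT.
have zE : z = parent v.
  apply: adj_lower; rewrite 1?eq_sym // 1?adj_sym //.
  by rewrite rank_le // !inE mem_rcons mem_head !orbT.
by rewrite yE zE eqxx in y_z.
Qed.

Lemma parent_spanning_tree : spanning_tree E.
Proof.
split; [| exact: parent_connected | exact: parent_acyclic].
move=> e /edge_parent [v v_root ->]; rewrite cards2.
case: eqP => // vE; have := rank_parent v_root; by rewrite -vE ltnn.
Qed.

End ParentTree.

(** * Zigzag paths *)

Lemma zigzag_edgesP (V : finType) (f g : nat -> V) k n e :
  reflect (exists j, [/\ (k <= j < k + n)%N & e = [set f j; g j]] \/
                     [/\ (k <= j)%N, (j.+1 < k + n)%N
                       & e = [set g j; f j.+1]])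
    (e \in path_edges (flatten [seq [:: f j; g j] | j <- iota k n])).
Proof.
(* As ordered pairs, the edges of the path on iota k n.+2 are (f k, g k),
   (g k, f k.+1) and those of the path on iota k.+1 n.+1. *)
have zigzag_zip : forall n k p,
    (p \in zip (flatten [seq [:: f j; g j] | j <- iota k n])
            (behead (flatten [seq [:: f j; g j] | j <- iota k n]))) <->
    (exists j, [/\ (k <= j < k + n)%N & p = (f j, g j)] \/
                     [/\ (k <= j)%N, (j.+1 < k + n)%N & p = (g j, f j.+1)]).
  clear; elim=> [|[|n] IHn] k p.
  - by split=> // -[j [[] | []]]; lia.
  - rewrite /= mem_seq1; split=> [/eqP-> | [j [[]|[]]]]; try lia.
      by exists k; left; split=> //; lia.
    by move=> jk ->; have -> : j = k by lia.
  have := IHn k.+1 p; rewrite /= !in_cons => IH; split.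
    case/or3P=> [/eqP-> | /eqP-> | /IH [j jP]].
    + by exists k; left; split=> //; lia.
    + by exists k; right; split=> //; lia.
    + exists j.
      by case: jP => [[? ->] | [? ? ->]]; [left | right]; split=> //; lia.
  case=> j jP; have [jk | jk] := eqVneq j k.
    by subst j; case: jP => [[_ ->] | [_ _ ->]]; rewrite eqxx ?orbT.
  apply/or3P; apply: Or33; apply/IH; exists j.
  by case: jP => [[? ->] | [? ? ->]]; [left | right]; split=> //; lia.
apply: (iffP imsetP) => [[p] /zigzag_zip [j jP] -> | [j jP]].
  by exists j; case: jP => [[? ->] | [? ? ->]]; [left | right]; split.
case: jP => [[? ->] | [? ? ->]].
  by exists (f j, g j) => //; apply/zigzag_zip; exists j; left.
by exists (g j, f j.+1) => //; apply/zigzag_zip; exists j; right.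
Qed.

(** * Cubics without quadratic term *)

Section Cubics.

Variable F : finFieldType.
Implicit Types a b c x : F.

Definition cubic_zeros a b c : {set F} := [set x | cubic a b c x == 0].

Lemma card_cubic_zeros a b c :
  (a, b, c) != (0, 0, 0) -> (#|cubic_zeros a b c| <= 3)%N.
Proof.
move=> abc0; pose p := Poly [:: c; - b; 0; a].
have p0 : p != 0.
  apply: contra abc0 => /eqP pE.
  have coefp i : p`_i = 0 by rewrite pE coef0.
  have := (coefp 0%N, coefp 1%N, coefp 3%N); rewrite !coef_Poly /=.
  by case=> -[-> /eqP]; rewrite oppr_eq0 => /eqP-> ->.
rewrite cardE -ltnS; apply: leq_trans (max_poly_roots p0 _ (enum_uniq _)) _.
  apply/allP=> x; rewrite mem_enum inE /cubic => /eqP xE.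
  rewrite rootE horner_Poly /= -[X in _ == X]xE; apply/eqP; ring.
exact: size_Poly.
Qed.

(** The bound of degree one holds when the leading coefficient is zero; this
    is what compensates for the extra common edge of two trees with equal a. *)
Lemma card_linear_zeros b c :
  (b, c) != (0, 0) -> (#|cubic_zeros 0%R b c| <= 1)%N.
Proof.
move=> bc0; apply/card_le1P => x; rewrite inE /cubic => /eqP xE y.
rewrite !inE /cubic; apply/eqP/eqP => [yE | -> //].
apply/eqP; rewrite -subr_eq0.
have: b * (y - x) = 0.
  transitivity ((0 * x ^+ 3 - b * x + c) - (0 * y ^+ 3 - b * y + c)).
    by ring.
  by rewrite xE yE subrr.
move/eqP; rewrite mulf_eq0 => /orP[/eqP b0 | //]; move: bc0 xE.
by rewrite b0 !mul0r subrr add0r => /eqP bc0 c0; case: bc0; rewrite c0.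
Qed.

End Cubics.

Arguments cubic_zeros {F} (a b c)%_R.

(** * The parameter set B *)

Section Construction.

Variables (m : nat) (F : finFieldType).
Hypotheses (m_gt0 : (0 < m)%N) (cardF : #|F| = (3 ^ m)%N).

(** The half h of q - 1 turns all parity and range side conditions into linear
    arithmetic. *)
Lemma cardF_half : exists2 h, (0 < h)%N & #|F| = h.*2.+1.
Proof.
exists (3 ^ m)./2; first by case: m m_gt0 => // k _; rewrite expnS; lia.
by rewrite cardF -[LHS]odd_double_half oddX orbT.
Qed.

Lemma pchar3 : 3 \in [pchar F].
Proof. exact: card_finPcharP cardF _. Qed.

Variable w : F.
Hypothesis w_prim : (#|F| - 1).-primitive_root w.
Implicit Types a b c x y z : F.

Lemma w_neq0 : w != 0.
Proof.
have [h h0 qE] := cardF_half.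
apply/eqP => w0; have := prim_expr_order w_prim.
rewrite w0 expr0n qE subn1 double_eq0 /=.
by case: eqP h0 => [-> // | _ _ /eqP]; rewrite eq_sym oner_eq0.
Qed.

Lemma powers_surj x : x != 0 -> exists2 j, (j < #|F| - 1)%N & x = w ^+ j.
Proof.
move=> x0; have [h h0 qE] := cardF_half.
have : x ^+ (#|F| - 1) = 1.
  apply: (mulfI x0); rewrite mulr1 -exprS -[RHS]expf_card; congr (_ ^+ _); lia.
by case/(prim_rootP w_prim) => j ->; exists j.
Qed.

(** As w has even order, the parity of an exponent of w is well defined. *)
Lemma odd_power i j : w ^+ i = w ^+ j -> odd i = odd j.
Proof.
have [h h0 qE] := cardF_half.
move=> /eqP; rewrite (eq_prim_root_expr w_prim) qE subn1 /= => /eqP ij.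
by rewrite -(odd_mod i (odd_double h)) ij odd_mod ?odd_double.
Qed.

(** The exponents run over 2, 4, ..., q - 1 here and over 1, 3, ..., q - 2 in
    [odd_powers]. *)
Definition even_powers : {set F} :=
  [set w ^+ i.*2.+2 | i : 'I_((#|F| - 1)./2)].
Definition odd_powers : {set F} :=
  [set w ^+ i.*2.+1 | i : 'I_((#|F| - 1)./2)].

Lemma even_powerP a : a \in even_powers -> exists2 i, ~~ odd i & a = w ^+ i.
Proof. by case/imsetP=> i _ ->; exists i.*2.+2 => //=; rewrite odd_double. Qed.

Lemma odd_powerP b : b \in odd_powers -> exists2 i, odd i & b = w ^+ i.
Proof. by case/imsetP=> i _ ->; exists i.*2.+1 => //=; rewrite odd_double. Qed.

Lemma mem_B a b c :
  ((a, b, c) \in B w) = (a \in even_powers) && (b \in odd_powers).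
Proof.
have [h h0 qE] := cardF_half.
have hE : ((#|F| - 1)./2 = h)%N by rewrite qE; lia.
rewrite inE; apply/existsP/andP => [[i /existsP[j]] | []].
  case/and5P=> i_le i_even j_le j_odd /= /andP[/eqP-> /eqP->].
  split; apply/imsetP.
    have i'P : (i./2.-1 < (#|F| - 1)./2)%N by lia.
    exists (Ordinal i'P) => //=; congr (_ ^+ _).
    rewrite -[LHS]odd_double_half (negbTE i_even) add0n -doubleS prednK //.
    by case/andP: i_le; case: (nat_of_ord i) => [|[]].
  have j'P : (j./2 < (#|F| - 1)./2)%N by lia.
  exists (Ordinal j'P) => //=; congr (_ ^+ _).
  by rewrite -[LHS]odd_double_half j_odd.
case/imsetP=> -[i /= i_lt] _ -> /imsetP[[j /= j_lt] _ ->].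
rewrite hE in i_lt j_lt.
have iP : (i.*2.+2 < #|F|)%N by rewrite qE; lia.
have jP : (j.*2.+1 < #|F|)%N by rewrite qE; lia.
exists (Ordinal iP); apply/existsP; exists (Ordinal jP) => /=.
by rewrite !odd_double !eqxx !andbT /= qE; lia.
Qed.

Lemma card_B : #|B w| = ((#|F| - 1)./2 ^ 2 * #|F|)%N.
Proof.
have [h h0 qE] := cardF_half.
have hE : ((#|F| - 1)./2 = h)%N by rewrite qE; lia.
have -> : B w = setX (setX even_powers odd_powers) setT.
  by apply/setP => -[[a b] c]; rewrite mem_B !inE /= andbT.
rewrite !cardsX cardsT !card_imset ?card_ord ?mulnn //.
  move=> [i i_lt] [j j_lt] ij; apply: val_inj => /=; move: ij => /= /eqP.
  rewrite hE in i_lt j_lt; rewrite (eq_prim_root_expr w_prim) qE subn1 /=.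
  by move=> /eqP ij; rewrite !modn_small in ij; lia.
move=> [i i_lt] [j j_lt] ij; apply: val_inj => /=; move: ij => /= /eqP.
rewrite hE in i_lt j_lt; rewrite (eq_prim_root_expr w_prim) qE subn1 /=.
rewrite -(addn2 i.*2) -(addn2 j.*2) eqn_modDr => /eqP ij.
by rewrite !modn_small in ij; lia.
Qed.

Lemma lead_neq0 a b c : (a, b, c) \in B w -> a != 0.
Proof.
rewrite mem_B => /andP[/even_powerP[i _ ->] _].
by rewrite expf_neq0 // w_neq0.
Qed.

(** Substituting wx for x multiplies the leading coefficient by w^3, which
    changes its parity; so p(wx) - p'(x) always has degree three. *)
Lemma even_powers_rotate a a' :
  a \in even_powers -> a' \in even_powers -> a * w ^+ 3 != a'.
Proof.
case/even_powerP=> i i_even -> /even_powerP[j j_even ->].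
apply/eqP; rewrite -exprD => /odd_power.
by rewrite oddD (negbTE i_even) (negbTE j_even).
Qed.

(** In characteristic 3, equal values at x != y would give a (x - y)^2 = b,
    so b would be an even power of w. *)
Lemma cubic_inj a b c : (a, b, c) \in B w -> injective (cubic a b c).
Proof.
rewrite mem_B => /andP[/even_powerP[i i_even aE] /odd_powerP[j j_odd bE]].
move=> x y; rewrite /cubic => /addIr xy.
apply/eqP; rewrite -subr_eq0; apply/negPn/negP => xy0.
have char3 : 3 = 0 :> F by exact: pcharf0 pchar3.
have abE : a * (x - y) ^+ 2 = b.
  apply: (mulIf xy0); rewrite -mulrA -exprSr; apply/eqP; rewrite -subr_eq0.
  have -> : a * (x - y) ^+ 3 - b * (x - y) =
      (a * x ^+ 3 - b * x) - (a * y ^+ 3 - b * y) - 3 * (a * x * y * (x - y)).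
    by ring.
  by rewrite xy char3 mul0r !subrr.
have [l _ lE] := powers_surj xy0.
move: abE; rewrite lE aE bE -exprM -exprD => /odd_power.
by rewrite j_odd oddD oddM andbF (negbTE i_even).
Qed.

(** * The edges of T_{a,b,c} *)

Definition cross (x y : F) : {set F + F} := [set inl x; inr y].

Lemma cross_inj x y x' y' : cross x y = cross x' y' -> x = x' /\ y = y'.
Proof.
move=> E; split.
  have: inl x \in cross x' y' by rewrite -E set21.
  by rewrite !inE orbF => /eqP [].
have: inr y \in cross x' y' by rewrite -E set22.
by rewrite !inE => /eqP [].
Qed.

Lemma cross_neq_inl x y z z' : cross x y <> [set inl z; inl z'].
Proof. by move/setP/(_ (inr y)); rewrite !inE eqxx orbT. Qed.

Lemma cubic0 a b c : cubic a b c 0 = c.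
Proof. by rewrite /cubic; ring. Qed.

(** Positions j on the stem are replaced by the field elements x = w^j, which
    makes both kinds of stem edges algebraic; the branch edge at (1,0) is
    absorbed in the second case as x = 0. *)
Lemma tree_edgesP a b c e :
  reflect [\/ e = [set inl a; inl 0],
              exists x, e = cross x (cubic a b c x)
            | exists x, [/\ x != 0, w * x != 1
                          & e = cross (w * x) (cubic a b c x)]]
          (e \in tree_abc w a b c).
Proof.
apply: (iffP setUP) =>
    [[/zigzag_edgesP[j [[jP ->]|[_ jP ->]]] | ] | [->|[x ->]|]].
- by apply: Or32; exists (w ^+ j).
- apply: Or33; exists (w ^+ j); rewrite expf_neq0 ?w_neq0 // -exprS setUC.
  by rewrite -(prim_order_dvd w_prim) gtnNdvd.
- by case/set2P=> ->; [exact: Or31 | apply: Or32; exists 0; rewrite cubic0].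
- by right; rewrite set21.
- have [-> | /powers_surj [j jP ->]] := eqVneq x 0.
    by right; rewrite cubic0 set22.
  by left; apply/zigzag_edgesP; exists j; left.
case=> x [/powers_surj [j jP ->] wj1 ->]; left; apply/zigzag_edgesP.
exists j; right; rewrite -exprS setUC; split=> //.
rewrite add0n ltn_neqAle jP andbT; apply: contraNneq wj1 => jE.
by rewrite -exprS jE (prim_expr_order w_prim).
Qed.

Lemma cross_in_tree x y a b c :
  cross x y \in tree_abc w a b c ->
  y = cubic a b c x \/
  exists z, [/\ z != 0, w * z != 1, x = w * z & y = cubic a b c z].
Proof.
case/tree_edgesP=> [/cross_neq_inl // | [z /cross_inj[-> ->]] | ]; first by left.
by case=> z [z0 wz1 /cross_inj[-> ->]]; right; exists z.
Qed.

(** The vertices (1,0) and (1,1) are on no rotated edge, so their only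
    neighbour in the second copy is (2,p(0)), respectively (2,p(1)). *)
Lemma tree_inj : {in B w &, injective (fun t => tree_abc w t.1.1 t.1.2 t.2)}.
Proof.
move=> [[a b] c] [[a' b'] c'] abcB abcB' /= treeE.
have value x : (x == 0) || (x == 1) -> cubic a b c x = cubic a' b' c' x.
  move=> x01; have: cross x (cubic a b c x) \in tree_abc w a' b' c'.
    by rewrite -treeE; apply/tree_edgesP; apply: Or32; exists x.
  case/cross_in_tree=> // -[z [z0 /negPf wz1 xE _]]; move: x01.
  by rewrite xE wz1 mulf_eq0 (negPf z0) (negPf w_neq0).
have aE : a = a'.
  have: [set inl a; inl 0] \in tree_abc w a' b' c'.
    by rewrite -treeE; apply/tree_edgesP; apply: Or31.
  case/tree_edgesP=>
    [|[x /esym/cross_neq_inl //]|[x [_ _ /esym/cross_neq_inl //]]].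
  move/setP/(_ (inl a)); rewrite set21 !inE => /esym /orP[/eqP[] // | /eqP[]].
  by move/eqP; rewrite (negPf (lead_neq0 abcB)).
have := value 0; rewrite !cubic0 eqxx => /(_ isT) cE.
have := value 1; rewrite eqxx orbT => /(_ isT); rewrite /cubic !mulr1 aE cE.
by move=> /addIr /addrI /oppr_inj ->.
Qed.

(** * T_{a,b,c} is a spanning tree *)

(** Discrete logarithm to base w. By the convention of [index], log 0 is q - 1,
    larger than all other values. *)
Definition log x := index x [seq w ^+ j | j <- iota 0 (#|F| - 1)].

Lemma log_pow j : (j < #|F| - 1)%N -> log (w ^+ j) = j.
Proof.
move=> j_lt; set s := [seq w ^+ k | k <- iota 0 (#|F| - 1)].
have s_uniq : uniq s.
  rewrite map_inj_in_uniq ?iota_uniq // => i k; rewrite !mem_iota => i_lt k_lt.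
  by move=> /eqP; rewrite (eq_prim_root_expr w_prim) !modn_small // => /eqP.
have size_s : size s = (#|F| - 1)%N by rewrite size_map size_iota.
have <- : s`_j = w ^+ j by rewrite (nth_map 0%N) ?size_iota // nth_iota.
by rewrite /log index_uniq // size_s.
Qed.

Lemma log0 : log 0 = (#|F| - 1)%N.
Proof.
rewrite /log memNindex ?size_map ?size_iota //.
by apply/mapP => -[j _ /esym/eqP]; rewrite expf_eq0 (negPf w_neq0) andbF.
Qed.

(** The rank follows the stem, x = w^j having rank 2j in the first copy and
    p(w^j) rank 2j + 1 in the second; as log 0 = q - 1, the branch vertices
    (1,0) and (2,c) come last without being special cases. *)
Lemma tree_spanning a b c :
  (a, b, c) \in B w -> spanning_tree (tree_abc w a b c).
Proof.
move=> abcB; pose p := cubic a b c.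
have a0 := lead_neq0 abcB; have p_inj : injective p by exact: cubic_inj.
pose parent (v : F + F) : F + F :=
  match v with
  | inl x => if x == 0 then inl a else inr (p (x / w))
  | inr y => inl (invF p_inj y)
  end.
pose rank (v : F + F) : nat :=
  match v with
  | inl x => (log x).*2
  | inr y => (log (invF p_inj y)).*2.+1
  end.
apply: (@parent_spanning_tree _ _ (inl 1) parent rank) => [v | v | e].
- case: v => [x | y _] //=; have [-> _ | x0] := eqVneq x 0.
    have [j j_lt ->] := powers_surj a0.
    by rewrite /= log0 log_pow // ltn_double.
  have [[|j] j_lt ->] := powers_surj x0; first by rewrite expr0 eqxx.
  rewrite /= exprSr mulfK ?w_neq0 // invF_f -exprSr !log_pow //; lia.
- case: v => [x | y _] /=; last first.
    rewrite setUC; apply/tree_edgesP; apply: Or32; exists (invF p_inj y).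
    by rewrite /cross -/p f_invF.
  have [-> _ | x0 x1] := eqVneq x 0.
    by rewrite setUC; apply/tree_edgesP; apply: Or31.
  have xE : w * (x / w) = x by rewrite mulrC divfK // w_neq0.
  apply/tree_edgesP; apply: Or33; exists (x / w); rewrite xE.
  by rewrite mulf_neq0 ?invr_neq0 ?w_neq0.
case/tree_edgesP=> [-> | [x ->] | [x [x0 wx1 ->]]].
- exists (inl 0); last by rewrite /= eqxx setUC.
  by apply/eqP=> -[/esym/eqP]; rewrite oner_eq0.
- by exists (inr (p x)); rewrite // /= invF_f setUC.
- exists (inl (w * x)); first by apply: contra wx1 => /eqP[->].
  by rewrite /= mulf_eq0 (negPf x0) (negPf w_neq0) mulrC mulfK // w_neq0.
Qed.

(** * Common edges of two trees *)

Lemma leq_cardsU (T : finType) (X Y : {set T}) k l :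
  (#|X| <= k)%N -> (#|Y| <= l)%N -> (#|X :|: Y| <= k + l)%N.
Proof. by move=> Xk Yl; apply: leq_trans (leq_card_setU X Y) (leq_add Xk Yl). Qed.

Lemma cubic_sub a b c a' b' c' x :
  cubic (a - a') (b - b') (c - c') x = cubic a b c x - cubic a' b' c' x.
Proof. by rewrite /cubic; ring. Qed.

Lemma cubic_scale a b c r x :
  cubic (a * r ^+ 3) (b * r) c x = cubic a b c (r * x).
Proof. by rewrite /cubic; ring. Qed.

(** One set for each way of being a common edge: inside the first copy, aligned
    in both trees, rotated in both, aligned in the first and rotated in the
    second, and conversely. *)
Lemma common_edges_sub a b c a' b' c' :
  tree_abc w a b c :&: tree_abc w a' b' c' \subset
    (if a == a' then [set [set inl a; inl 0]] else set0) :|: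
    [set cross x (cubic a b c x)
       | x in cubic_zeros (a - a') (b - b') (c - c')] :|:
    [set cross (w * x) (cubic a b c x)
       | x in cubic_zeros (a - a') (b - b') (c - c')] :|:
    [set cross (w * x) (cubic a' b' c' x)
       | x in cubic_zeros (a * w ^+ 3 - a') (b * w - b') (c - c')] :|:
    [set cross (w * x) (cubic a b c x)
       | x in cubic_zeros (a' * w ^+ 3 - a) (b' * w - b) (c' - c)].
Proof.
apply/subsetP=> e /setIP[/tree_edgesP[-> | [x ->] | [x [x0 wx1 ->]]]].
- case/tree_edgesP=>
    [|[x /esym/cross_neq_inl //]|[x [_ _ /esym/cross_neq_inl //]]].
  move=> eE; do 4 (apply/setUP; left); suff -> : a = a' by rewrite eqxx set11.
  have: inl a \in [set inl a'; inl 0 : F + F] by rewrite -eE set21.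
  have: inl a' \in [set inl a; inl 0 : F + F] by rewrite eE set21.
  by rewrite !inE => /orP[/eqP[->] // | /eqP[->]] /orP[/eqP[->] | /eqP[->]].
- case/cross_in_tree=> [xE | [z [_ _ xE zE]]].
    do 3 (apply/setUP; left); apply/setUP; right.
    by apply: imset_f; rewrite inE cubic_sub xE subrr.
  apply/setUP; left; apply/setUP; right; rewrite zE xE.
  by apply: imset_f; rewrite inE cubic_sub cubic_scale -xE zE subrr.
- case/cross_in_tree=> [xE | [z [_ _ /(mulfI w_neq0) xE zE]]].
    apply/setUP; right.
    by apply: imset_f; rewrite inE cubic_sub cubic_scale -xE subrr.
  do 2 (apply/setUP; left); apply/setUP; right.
  by apply: imset_f; rewrite inE cubic_sub {2}xE zE subrr.
Qed.

Lemma card_common_edges a b c a' b' c' :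
  (a, b, c) \in B w -> (a', b', c') \in B w -> (a, b, c) != (a', b', c') ->
  (#|tree_abc w a b c :&: tree_abc w a' b' c'| <= 12)%N.
Proof.
rewrite !mem_B => /andP[aP _] /andP[aP' _] abc_neq.
apply: leq_trans (subset_leq_card (common_edges_sub a b c a' b' c')) _.
have rotated u v z z' t : u \in even_powers -> v \in even_powers ->
    (#|cubic_zeros (u * w ^+ 3 - v) (z * w - z') t| <= 3)%N.
  move=> uP vP; apply: card_cubic_zeros; rewrite !xpair_eqE subr_eq0.
  by rewrite (negPf (even_powers_rotate uP vP)).
have zeros12 := rotated _ _ b b' (c - c') aP aP'.
have zeros21 := rotated _ _ b' b (c' - c) aP' aP.
(* If a = a', the extra common edge is outweighed by the drop in degree. *)
have same_kind : ((a == a') +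
    2 * #|cubic_zeros (a - a') (b - b') (c - c')| <= 6)%N.
  have [aE | aa'] := eqVneq a a'.
    have: (#|cubic_zeros (a - a') (b - b') (c - c')| <= 1)%N.
      rewrite aE subrr; apply: card_linear_zeros; move: abc_neq.
      by rewrite aE !xpair_eqE !subr_eq0 eqxx.
    lia.
  have: (#|cubic_zeros (a - a') (b - b') (c - c')| <= 3)%N.
    by apply: card_cubic_zeros; rewrite !xpair_eqE subr_eq0 (negPf aa').
  lia.
pose z := #|cubic_zeros (a - a') (b - b') (c - c')|.
apply: (@leq_trans ((a == a') + z + z + 3 + 3)%N); last by rewrite /z; lia.
do 4 (apply: leq_cardsU; last exact: leq_trans (leq_imset_card _ _) _).
by case: (a == a'); rewrite ?cards1 ?cards0.
Qed.

End Construction.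

Theorem mainTheorem6 (m q n : nat) (F : finFieldType) (w : F)
    (hm : (0 < m)%N) (hq : q = (3 ^ m)%N) (hn : n = (2 * q)%N)
    (hF : #|F| = q) (hw : (q - 1)%N.-primitive_root w) :
  (32 %| n * (n - 2) ^ 2)%N /\
  tree_code n (n * (n - 2) ^ 2 %/ 32)%N (n%:Z - 13) (C2 w).
Proof.
subst q n; move: hw; rewrite -hF => hw.
have [h h_gt0 qE] := cardF_half hm hF.
(* n (n - 2)^2 = 2q (4h)^2 = 32 h^2 q, where h = (q - 1)/2. *)
have sizeE : (2 * #|F| * (2 * #|F| - 2) ^ 2 = (h ^ 2 * #|F|) * 32)%N.
  rewrite qE; have -> : (2 * h.*2.+1 - 2 = 4 * h)%N by lia.
  by rewrite expnMn; ring.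
have cardV : #|{: F + F}| = (2 * #|F|)%N by rewrite card_sum mul2n addnn.
rewrite sizeE dvdn_mull // mulnK //; split=> //; split=> //.
- move=> T /imsetP[[[a b] c] abcB ->]; exact: (tree_spanning hm hF hw abcB).
- rewrite card_in_imset ?(card_B hm hF hw); last exact: (tree_inj hm hF hw).
  by congr (_ ^ 2 * _)%N; rewrite qE; lia.
move=> _ _ /imsetP[[[a b] c] abcB ->] /imsetP[[[a' b'] c'] abcB' ->] neq.
rewrite /tree_dist cardV /=.
have abc_neq : (a, b, c) != (a', b', c').
  by apply: contraNneq neq => -[-> -> ->].
have := card_common_edges hm hF hw abcB abcB' abc_neq.
by move: #|_ :&: _| (2 * #|F|)%N => k n; lia.
Qed.
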